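(* Let $T_1>0$, let $n\ge1$ be an integer and let $r$ be real with $0\le r<T_1$. Put $$w_{24}(l)=\frac{(3l-2n+1)T_1+(2n-2l+3)r}{2(l+1)},\qquad r_c=\left(\frac{2n+2}{2n+5}\right)T_1 .$$ Regarding $l$ as a real variable, $$\frac{dw_{24}}{dl}=\frac{(2n+5)(r_c-r)}{2(l+1)^2}.$$ Hence, on the range $l\ge n+1$: if $r<r_c$, then $w_{24}$ is strictly increasing and its minimum is attained at $l=n+1$; if $r>r_c$, then $w_{24}$ is strictly decreasing and its infimum is its limit as $l\to\infty$; if $r=r_c$, then $w_{24}$ is constant in $l$.
   Context: Here $T_2=nT_1+r\ge T_1$ is the travel time of a second route $R_2$ and $T_1$ that of a first route $R_1$. The function $w_{24}(l)$ is the total waiting time of a passenger making the journey $R_1\to R_2\to R_1$ when the departures $x_1(k)$ on $R_1$ follow $x_1(k)=\max(T_1+x_1(k-1),\,r+(l+1)T_1+x_1(k-(l+1)))$ with synchronization parameter $l>n$; for this statement $w_{24}(l)$ is defined by the displayed formula. *)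

(* Defs.v *)
From Stdlib Require Import Reals.
From Coquelicot Require Import Coquelicot.
Open Scope R_scope.

(* Total waiting time on the journey R1 -> R2 -> R1, where the travel times are
   T1 on R1 and n * T1 + r on R2; the synchronization parameter l is real. *)
Definition w24 (T1 : R) (n : nat) (r l : R) : R :=
  ((3 * l - 2 * INR n + 1) * T1 + (2 * INR n - 2 * l + 3) * r) / (2 * (l + 1)).

Definition r_crit (T1 : R) (n : nat) : R :=
  (2 * INR n + 2) / (2 * INR n + 5) * T1.

Definition strictly_increasing_on (D : R -> Prop) (f : R -> R) : Prop :=
  forall x y : R, D x -> D y -> x < y -> f x < f y.

Definition strictly_decreasing_on (D : R -> Prop) (f : R -> R) : Prop :=
  forall x y : R, D x -> D y -> x < y -> f y < f x.

Definition constant_on (D : R -> Prop) (f : R -> R) : Prop :=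
  forall x y : R, D x -> D y -> f x = f y.

Definition min_attained_at (D : R -> Prop) (f : R -> R) (a : R) : Prop :=
  D a /\ forall x : R, D x -> f a <= f x.

Definition image_on (D : R -> Prop) (f : R -> R) : R -> Prop :=
  fun y => exists x : R, D x /\ y = f x.

Definition sync_range (n : nat) : R -> Prop := fun l => INR n + 1 <= l.

(* Main.v *)
Require Import Defs.
From Stdlib Require Import Reals Lra.
From Coquelicot Require Import Coquelicot.
Open Scope R_scope.

(** As a function of [l], the waiting time is a homographic function with pole
    at [-1]: its numerator is affine in [l + 1], and dividing out gives
    [w24 l = L - K / (2 (l + 1))] with [L = (3 T1 - 2 r) / 2] and
    [K = (2 n + 5) (r_crit - r)] ([w24_hyperbola]).  The critical value
    [r_crit] is exactly the value of [r] for which the pole disappears.  The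
    derivative [K / (2 (l + 1)^2)] can be read off this form, and so can the
    increment between two points, [K (y - x) / (2 (x + 1) (y + 1))]
    ([w24_increment]), which settles the three monotonicity cases by the sign
    of [K].  For [K < 0] the function stays above its limit [L] at infinity,
    and a lower bound that is also a limit is the infimum
    ([is_glb_of_lim]). *)

(** Values above [L] make [L] a lower bound; every other lower bound passes to
    the limit in [b <= f x] and so is at most [L]. *)
Lemma is_glb_of_lim (D : R -> Prop) (f : R -> R) (L : R) :
  Rbar_locally p_infty D ->
  (forall x, D x -> L <= f x) ->
  is_lim f p_infty L ->
  is_glb_Rbar (image_on D f) L.
Proof.
  intros [M HM] Hlow Hlim. split.
  - intros y [x [Dx ->]]. exact (Hlow x Dx).
  - intros b Hb. destruct b as [b| |].
    + apply (is_lim_le_loc (fun _ => b) f p_infty b L).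
      * exists M. intros x Hx. apply (Hb (f x)). exists x. split; auto.
      * apply is_lim_const.
      * exact Hlim.
    (* The image is nonempty, so [p_infty] is not one of its lower bounds. *)
    + exfalso. apply (Hb (f (M + 1))).
      exists (M + 1). split; [apply HM; lra | reflexivity].
    + exact I.
Qed.

Lemma w24_hyperbola (T1 : R) (n : nat) (r l : R) :
  l <> -1 ->
  w24 T1 n r l =
    (3 * T1 - 2 * r) / 2
    - (2 * INR n + 5) * (r_crit T1 n - r) / 2 * / (l + 1).
Proof.
  intros Hl. pose proof (pos_INR n) as Hn.
  unfold w24, r_crit. field. split; lra.
Qed.

Lemma w24_increment (T1 : R) (n : nat) (r x y : R) :
  x <> -1 -> y <> -1 ->
  w24 T1 n r y - w24 T1 n r x =
    (2 * INR n + 5) * (r_crit T1 n - r)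
    * ((y - x) / (2 * (x + 1) * (y + 1))).
Proof.
  intros Hx Hy. rewrite !w24_hyperbola by assumption. field. split; lra.
Qed.

Lemma is_derive_w24 (T1 : R) (n : nat) (r l : R) :
  l <> -1 ->
  is_derive (w24 T1 n r) l
    ((2 * INR n + 5) * (r_crit T1 n - r) / (2 * (l + 1) ^ 2)).
Proof.
  intros Hl. pose proof (pos_INR n) as Hn.
  unfold w24, r_crit. auto_derive; [lra | field; split; lra].
Qed.

Lemma is_lim_w24 (T1 : R) (n : nat) (r : R) :
  is_lim (w24 T1 n r) p_infty ((3 * T1 - 2 * r) / 2).
Proof.
  set (L := (3 * T1 - 2 * r) / 2).
  set (c := (2 * INR n + 5) * (r_crit T1 n - r) / 2).
  apply (is_lim_ext_loc (fun l => L - c * / (l + 1))).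
  { exists 0. intros l Hl. symmetry. apply w24_hyperbola. lra. }
  assert (Hinv : is_lim (fun l => / (l + 1)) p_infty 0).
  { change (Finite 0) with (Rbar_inv p_infty).
    apply is_lim_inv; [| discriminate].
    apply (is_lim_plus _ _ _ p_infty 1);
      [apply is_lim_id | apply is_lim_const | reflexivity]. }
  replace (Finite L) with (Finite (L - c * 0)) by (f_equal; ring).
  apply is_lim_minus'; [apply is_lim_const |].
  exact (is_lim_scal_l _ c _ _ Hinv).
Qed.

Lemma increment_quotient_pos (x y : R) :
  -1 < x -> x < y -> 0 < (y - x) / (2 * (x + 1) * (y + 1)).
Proof.
  intros Hx Hxy. apply Rdiv_lt_0_compat; [lra |].
  repeat apply Rmult_lt_0_compat; lra.
Qed.

Theorem mainTheorem3 (T1 : R) (n : nat) (r : R)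
  (hT1 : 0 < T1) (hn : (1 <= n)%nat) (hr0 : 0 <= r) (hrT1 : r < T1) :
  (forall l : R, l <> -1 ->
     is_derive (w24 T1 n r) l
       ((2 * INR n + 5) * (r_crit T1 n - r) / (2 * (l + 1) ^ 2)))
  /\ (r < r_crit T1 n ->
        strictly_increasing_on (sync_range n) (w24 T1 n r)
        /\ min_attained_at (sync_range n) (w24 T1 n r) (INR n + 1))
  /\ (r > r_crit T1 n ->
        strictly_decreasing_on (sync_range n) (w24 T1 n r)
        /\ exists L : R,
             is_lim (w24 T1 n r) p_infty L
             /\ is_glb_Rbar (image_on (sync_range n) (w24 T1 n r)) L)
  /\ (r = r_crit T1 n ->
        constant_on (sync_range n) (w24 T1 n r)).
Proof.
  pose proof (pos_INR n) as Hn.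
  split; [intros l; apply is_derive_w24 |].
  split; [| split]; unfold sync_range; intros Hr.
  - assert (Hinc : strictly_increasing_on (sync_range n) (w24 T1 n r)).
    { unfold sync_range. intros x y Hx Hy Hxy. apply Rlt_0_minus.
      rewrite w24_increment by lra.
      apply Rmult_lt_0_compat;
        [apply Rmult_lt_0_compat; lra | apply increment_quotient_pos; lra]. }
    split; [exact Hinc |]. split; [apply Rle_refl |].
    intros x [Hx | <-]; [| apply Rle_refl].
    left. apply Hinc; [apply Rle_refl | left; exact Hx | exact Hx].
  - assert (HK : (2 * INR n + 5) * (r_crit T1 n - r) < 0).
    { apply Rmult_pos_neg; lra. }
    split.
    + intros x y Hx Hy Hxy. apply Rminus_lt.
      rewrite w24_increment by lra.
      apply Rmult_neg_pos; [exact HK | apply increment_quotient_pos; lra].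
    + exists ((3 * T1 - 2 * r) / 2). split; [apply is_lim_w24 |].
      apply is_glb_of_lim; [| | apply is_lim_w24].
      * exists (INR n + 1). intros x. apply Rlt_le.
      * intros x Hx. rewrite w24_hyperbola by lra.
        assert (0 < / (x + 1)) by (apply Rinv_0_lt_compat; lra).
        assert ((2 * INR n + 5) * (r_crit T1 n - r) / 2 * / (x + 1) < 0)
          by (apply Rmult_neg_pos; lra).
        lra.
  - intros x y Hx Hy. apply Rminus_diag_uniq.
    rewrite w24_increment, <- Hr by lra. ring.
Qed.
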